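(* Let $P$ and $Q$ be two finite posets. (a) If $P$ is an antichain, then $J_{P,Q}$ is generated by quadratic squarefree binomials. (b) If $P$ is not an antichain and each connected component of $P$ is rooted or co-rooted, then the following conditions are equivalent: (i) $J_{P,Q}$ is generated by quadratic binomials. (ii) $J_{P,Q}$ is generated by quadratic squarefree binomials. (iii) Each proper poset cycle of $Q$ of length $\geq 6$ has a chord.
   Context: Let $K$ be a field. For finite posets $P,Q$, let $\mathrm{Hom}(P,Q)$ be the set of isotone (order preserving) maps $P\to Q$. The isotonian algebra $K[P,Q]$ is the $K$-subalgebra of $K[x_{p,q} : p\in P,\ q\in Q]$ generated by the monomials $u_\varphi=\prod_{p\in P}x_{p,\varphi(p)}$, $\varphi\in \mathrm{Hom}(P,Q)$. Let $T=K[t_\varphi : \varphi\in \mathrm{Hom}(P,Q)]$ be the polynomial ring, and let $J_{P,Q}\subset T$ be the kernel of the $K$-algebra homomorphism $T\to K[P,Q]$, $t_\varphi\mapsto u_\varphi$. A poset is connected if its Hasse diagram is connected as a graph; the connected components of $P$ are the connected posets of which $P$ is the disjoint sum (elements in different summands being incomparable). A finite poset is rooted if it has a unique minimal element and for every element $p$ the set of elements $\leq p$ is a chain; it is co-rooted if the dual poset is rooted. A binomial is a difference $u-v$ of two monomials; it is squarefree if both $u$ and $v$ are squarefree, and quadratic if it is homogeneous of degree $2$. The zero ideal is regarded as generated by the empty set. A sequence $q_1,q_2,\ldots,q_{2m}$ of elements of $Q$ is a poset cycle of length $2m$ if $q_1\leq q_2\geq q_3\leq\cdots\leq q_{2m}\geq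 q_1$. A poset cycle of length $2m\geq 6$ has a chord if there exist an odd index $i$ and an even index $j$ in $\{1,\ldots,2m\}$ with $j\neq i-1,i+1$ (where the index $0$ is identified with $2m$) such that $q_i\leq q_j$. A poset cycle is proper if all its elements $q_i$ are pairwise distinct, the elements with even indices are pairwise incomparable, and the elements with odd indices are pairwise incomparable. *)

(* Defs.v *)
From mathcomp Require Import all_boot all_order all_algebra.
From mathcomp Require Import mpoly.

Set Implicit Arguments.
Unset Strict Implicit.
Unset Printing Implicit Defensive.

Import Order.TTheory GRing.Theory.

Local Open Scope ring_scope.

(* Polynomial rings whose variables are indexed by a finite type I are encoded
   as {mpoly K[#|I|]}; the variable of index i : I is 'X_(enum_rank i). *)

Section IsotonianAlgebra.
Context (K : fieldType) (dP dQ : Order.disp_t).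
Context (P : finPOrderType dP) (Q : finPOrderType dQ).

Definition isotone (f : {ffun P -> Q}) : bool :=
  [forall p, forall p', (p <= p')%O ==> (f p <= f p')%O].

Definition isoHom : finType := {f : {ffun P -> Q} | isotone f}.

Definition isoMonomial (phi : isoHom) : {mpoly K[#|{: P * Q}|]} :=
  \prod_(p : P) 'X_(enum_rank (p, val phi p)).

(* The K-algebra morphism t_phi |-> u_phi.  Its image is the isotonian algebra;
   it is written here with values in the ambient polynomial ring, which does
   not affect its kernel. *)
Definition isoMap (f : {mpoly K[#|isoHom|]}) : {mpoly K[#|{: P * Q}|]} :=
  f \mPo [tuple isoMonomial (enum_val i) | i < #|isoHom|].

Definition isoIdeal (f : {mpoly K[#|isoHom|]}) : Prop := isoMap f = 0.

End IsotonianAlgebra.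

Section Binomials.
Context (K : fieldType) (n : nat).
Implicit Types (S J C : {mpoly K[n]} -> Prop) (f : {mpoly K[n]}).

Definition in_ideal_span S f : Prop :=
  exists s : seq ({mpoly K[n]} * {mpoly K[n]}),
    (forall c, c \in s -> S c.2) /\ f = \sum_(c <- s) c.1 * c.2.

(* J is the ideal generated by some (possibly empty) set of elements of C. *)
Definition generated_by C J : Prop :=
  exists S, (forall g, S g -> C g) /\ (forall f, J f <-> in_ideal_span S f).

Definition squarefree_mnm (u : 'X_{1..n}) : Prop := forall i, (u i <= 1)%N.

Definition quadratic_binomial f : Prop :=
  (exists u v : 'X_{1..n}, f = 'X_[u] - 'X_[v]) /\ f \is 2.-homog.

Definition quadratic_squarefree_binomial f : Prop :=
  (exists u v : 'X_{1..n},
     [/\ squarefree_mnm u, squarefree_mnm v & f = 'X_[u] - 'X_[v]]) /\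
  f \is 2.-homog.

End Binomials.

Section Posets.
Context (d : Order.disp_t) (P : finPOrderType d).

Definition is_antichain : Prop := forall x y : P, x != y -> (x >< y)%O.

Definition covered_by (x y : P) : bool :=
  (x < y)%O && [forall z, ~~ ((x < z)%O && (z < y)%O)].

Definition hasse (x y : P) : bool := covered_by x y || covered_by y x.

(* The vertex sets of the connected components of the Hasse diagram; each is
   regarded as a poset with the order induced from P. *)
Definition components : {set {set P}} :=
  [set [set y | connect hasse x y] | x : P].

Definition minimal_in (C : {set P}) (m : P) : Prop :=
  m \in C /\ (forall x, x \in C -> (x <= m)%O -> x = m).

Definition rooted (C : {set P}) : Prop :=
  (exists! m, minimal_in C m) /\
  (forall p, p \in C ->
     {in C &, forall x y, (x <= p)%O -> (y <= p)%O -> (x >=< y)%O}).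

End Posets.

Definition co_rooted (d : Order.disp_t) (P : finPOrderType d) (C : {set P}) :
  Prop := @rooted _ (P^d)%type C.

(* Poset cycles of length m.*2 are indexed from 0, so that q i stands for
   q_(i+1): the parity of an index is opposite to that of the usual numbering
   from 1.  The cyclic successor and predecessor are ordS and ord_pred. *)
Section Cycles.
Context (d : Order.disp_t) (Q : finPOrderType d) (m : nat).
Implicit Type q : 'I_m.*2 -> Q.

Definition poset_cycle q : Prop :=
  forall i : 'I_m.*2, if odd i then (q (ordS i) <= q i)%O else (q i <= q (ordS i))%O.

Definition has_chord q : Prop :=
  exists i j : 'I_m.*2,
    [/\ ~~ odd i, odd j, j != ord_pred i, j != ordS i & (q i <= q j)%O].

Definition proper_cycle q : Prop :=
  injective q /\
  (forall i j : 'I_m.*2, odd i = odd j -> i != j -> (q i >< q j)%O).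

End Cycles.

(* Main.v *)
(** A binomial relation compares two tuples of isotone maps with the same
    multiset of values at each element of [P]; quadratic generation means that
    any two such tuples are connected by exchanging values between two maps at
    a time.  If the components of [P] are rooted or co-rooted, every element [c]
    has at most one parent [p], and exchanging the values of two maps on the
    whole subtree of [c] keeps them isotone as soon as the values at [p] and [c]
    stay comparable.  So one has to connect perfect matchings, between the values
    at [p] and those at [c], of the comparability graph of [Q] by transpositions.
    Two matchings differ along alternating cycles, which are poset cycles of [Q],
    and a chord (available even for non-proper cycles, since a chordless cycle is
    proper) lets one shorten them.  Conversely a chordless proper cycle has two
    perfect matchings that no transposition can leave, which yields a binomial
    relation not generated by quadratic ones. *)

From mathcomp Require Import all_boot all_order all_fingroup all_algebra.
From mathcomp Require Import zify.
From mathcomp Require Import mpoly.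
Require Import Defs.

Set Implicit Arguments.
Unset Strict Implicit.
Unset Printing Implicit Defensive.

Import Order.TTheory GRing.Theory.

(** * Perfect matchings as permutations, connected by transpositions *)

Section PermConnect.
Variable n : nat.
Implicit Types (V : rel 'I_n) (s t nu mu : 'S_n).

Definition matching V s := forall i, V i (s i).

(** The cycle of [nu] through [x] carries an alternating cycle of the matchings [s] and [nu * s].
    From [iter r nu x], exponents [k = 0] and [k = 1] would give the edges of [s] and [nu * s]; the
    bounds on [k] leave exactly the chords. *)
Definition chordal_rel V := forall s nu x,
  matching V s -> matching V (nu * s)%g -> 2 < fingraph.order nu x ->
  exists r k, 1 < k < fingraph.order nu x /\ V (iter r nu x) (s (iter (k + r) nu x)).

(** Since [nu] maps [x |: A] onto [y |: A], sending [x] to [y] and fixing [A] does not disturb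
    injectivity. With [A] the interior of an arc from [x] to [y], this cuts the arc out of its
    cycle. *)
Lemma perm_shortcut nu (A : {set 'I_n}) x y : x \notin A -> y \notin A ->
  (forall z, (nu z \in y |: A) = (z \in x |: A)) ->
  exists mu, [/\ mu x = y, {in A, mu =1 id} &
                 forall z, z \notin x |: A -> mu z = nu z].
Proof.
move=> xA yA nuA; pose f z := if z == x then y else if z \in A then z else nu z.
have f_inj : injective f.
  move=> u v; rewrite /f.
  have := nuA u; have := nuA v; rewrite !inE.
  case: (eqVneq u x) => [->|ux]; case: (eqVneq v x) => [->|vx] //=.
  - case: ifP => [vA _ _ e|vA]; first by rewrite e vA in yA.
    by move=> h _ e; rewrite -e eqxx in h.
  - case: ifP => [uA _ _ e|uA]; first by rewrite -e uA in yA.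
    by move=> _ h e; rewrite e eqxx in h.
  - case: ifP => [uA|uA]; case: ifP => [vA|vA] //.
    + by move=> h _ e; rewrite -e uA orbT in h.
    + by move=> _ h e; rewrite e vA orbT in h.
    + by move=> _ _; apply: perm_inj.
exists (perm f_inj); split=> [|z zA|z]; rewrite permE /f ?eqxx //.
  by rewrite zA; case: eqP => // e; rewrite -e zA in xA.
by rewrite !inE => /norP[/negPf-> /negPf->].
Qed.

Lemma iter_perm_neq nu x k : 0 < k < fingraph.order nu x -> iter k nu x != x.
Proof.
move=> /andP[k_gt0 ltk]; apply/eqP => e.
by have := findex_iter ltk; rewrite e (findex0 nu x) => e0; rewrite -e0 in k_gt0.
Qed.

Lemma iter_perm_inj (nu : 'S_n) k : injective (iter k nu).
Proof. by elim: k => //= k IH i j /perm_inj /IH. Qed.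

(* Two matchings differ along alternating cycles.  A chord of such a cycle gives
   a third matching, which follows one of them on one side of the chord and the
   other one on the other side, and hence is closer to both. *)
Lemma matchings_connected V (E : 'S_n -> 'S_n -> Prop) : chordal_rel V ->
  (forall s, E s s) -> (forall s t u, E s t -> E t u -> E s u) ->
  (forall s i j, matching V s -> matching V (tperm i j * s)%g ->
     E s (tperm i j * s)%g) ->
  forall s t, matching V s -> matching V t -> E s t.
Proof.
move=> Vch E1 Etr Esw s t.
have [d] := ubnP #|[set i | s i != t i]|.
elim: d s t => // d IH s t lt_d Vs Vt.
case: (pickP (fun i => s i != t i)) => [x nx|st]; last first.
  suff -> : s = t by []; apply/permP => i.
  by apply/eqP; move: (st i); case: eqP.
(* The nontrivial cycles of [nu] are the alternating cycles along which [s] and [t] differ. *)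
have [nu snu] : exists nu : 'S_n, forall z, s (nu z) = t z.
  by exists (t * s^-1)%g => z; rewrite permM permKV.
have nuE z : (s z != t z) = (nu z != z) by rewrite -snu (inj_eq perm_inj) eq_sym.
have nuI : injective nu := @perm_inj _ nu.
have nux : nu x != x by rewrite -nuE.
have iterE k : (nu (iter k nu x) = iter k nu x) -> False.
  move=> e; case/eqP: nux; apply: (@iter_perm_inj nu k).
  by rewrite -iterSr iterS.
have o_gt1 : 1 < fingraph.order nu x.
  have := iter_order nuI x; have := fingraph.order_gt0 nu x.
  by case: (fingraph.order nu x) => [|[|]] //= _ e; rewrite e eqxx in nux.
(* On a 2-cycle of [nu], a single transposition makes [s] agree with [t] at both points. *)
have [o_gt2|o_le2] := ltnP 2 (fingraph.order nu x); last first.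
  have e2 : nu (nu x) = x.
    by have := iter_order nuI x; have -> : fingraph.order nu x = 2 by lia.
  have rhoE z : (tperm x (nu x) * s)%g z != t z -> s z != t z /\ z != x.
    rewrite permM; case: tpermP => [->|->|/eqP zx _]; last by [].
      by rewrite snu eqxx.
    by rewrite -{1}e2 snu eqxx.
  have Vrho : matching V (tperm x (nu x) * s)%g.
    move=> z; have := rhoE z; case: eqP => [-> //|/eqP h /(_ isT)[_ zx]].
    rewrite permM; case: tpermP => [/eqP|->|_ _]; first by rewrite (negPf zx).
      by rewrite -{2}e2 snu; apply: Vt.
    exact: Vs.
  apply: Etr (Esw _ _ _ Vs Vrho) _.
  apply: IH => //; apply: leq_trans (_ : #|[set i | s i != t i]| <= d); last by [].
  apply: proper_card; apply/properP; split.
    by apply/subsetP=> z; rewrite !inE => /rhoE[].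
  by exists x; rewrite !inE // permM tpermL snu eqxx.
have Vnu : matching V (nu * s)%g by move=> i; rewrite permM snu.
have [r [k [/andP[k1 ko] Vk]]] := Vch _ _ _ Vs Vnu o_gt2.
rewrite iterD in Vk; set y := iter r nu x in Vk.
have iter_inj := @iter_perm_inj nu.
have yE i j : i < j < fingraph.order nu x -> iter i nu y != iter j nu y.
  move=> /andP[ij jo]; rewrite -(subnKC (ltnW ij)) iterD (inj_eq (iter_inj _)).
  rewrite /y -iterD addnC iterD (inj_eq (iter_inj _)) eq_sym.
  by apply: iter_perm_neq; lia.
have ynu m : nu (iter m nu y) != iter m nu y.
  by apply/eqP; rewrite /y -iterD => /iterE.
(* The interior of the arc from [y] to [iter k nu y], whose endpoints span the chord. *)
pose A := [set iter m.+1 nu y | m : 'I_k.-1].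
have inA z : reflect (exists2 m, 0 < m < k & z = iter m nu y) (z \in A).
  apply: (iffP imsetP) => [[m _ ->]|[m mk ->]].
    by exists m.+1 => //; have := ltn_ord m; lia.
  have mk' : m.-1 < k.-1 by lia.
  by exists (Ordinal mk') => //; rewrite /= -iterS prednK //; case/andP: mk.
have yA : y \notin A.
  apply/inA => -[m mk /eqP e]; have := yE 0 m; rewrite /= e; lia.
have zA : iter k nu y \notin A.
  apply/inA => -[m mk /eqP e]; have := yE m k; rewrite eq_sym e; lia.
have nuA z : (nu z \in iter k nu y |: A) = (z \in y |: A).
  rewrite !in_setU1; apply/orP/orP.
    case=> [/eqP|/inA[m mk]].
      rewrite -(ltn_predK k1) iterS => /nuI ->.
      by right; apply/inA; exists k.-1 => //; lia.
    case/andP: (mk) => m0 _; rewrite -(ltn_predK m0) iterS => /nuI ->.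
    case: m m0 mk => // -[|m] _ mk; first by left.
    by right; apply/inA; exists m.+1 => //=; lia.
  case=> [/eqP->|/inA[m mk ->]].
    by right; apply/inA; exists 1.
  rewrite -iterS; have [->|mk'] := eqVneq m.+1 k; first by left.
  by right; apply/inA; exists m.+1 => //; lia.
have [mu [muy muA muN]] := perm_shortcut yA zA nuA.
have Vmu : matching V (mu * s)%g.
  move=> z; rewrite permM.
  have [/setU1P[->|/muA->]|/muN->] := boolP (z \in y |: A).
  - by rewrite muy.
  - exact: Vs.
  - by rewrite snu.
have Anu z : z \in y |: A -> nu z != z.
  by case/setU1P => [->|/inA[m _ ->]]; [apply: (ynu 0) | apply: ynu].
have lt_d' : #|[set i | s i != t i]| <= d by [].
(* The matching [mu * s] agrees with [s] on [A], which contains [nu y] because [1 < k], and with [t]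
   outside [y |: A], in particular at [iter k nu y] because [k] is less than the length of the
   cycle. Both distances thus drop. *)
apply: (Etr _ (mu * s)%g); apply: IH => //; apply: leq_trans lt_d';
  apply: proper_card; apply/properP; split.
- apply/subsetP => z; rewrite !inE permM (inj_eq perm_inj) nuE.
  have [/Anu //|/muN->] := boolP (z \in y |: A).
  by rewrite eq_sym.
- have A1 : nu y \in A by apply/inA; exists 1.
  exists (nu y); first by rewrite inE nuE (ynu 1).
  by rewrite inE permM muA ?eqxx.
- apply/subsetP => z; rewrite !inE permM nuE.
  have [/Anu //|/muN->] := boolP (z \in y |: A).
  by rewrite snu eqxx.
- exists (iter k nu y); first by rewrite inE nuE ynu.
  rewrite inE permM muN ?snu ?eqxx // in_setU1 negb_or zA andbT.
  by rewrite eq_sym; apply: (yE 0); lia.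
Qed.

End PermConnect.

(** * Cyclic indices and chords of poset cycles *)

Lemma val_iter_ordS m k (i : 'I_m) : val (iter k (@ordS m) i) = (i + k) %% m.
Proof.
elim: k => [|k IH] /=; first by rewrite addn0 modn_small.
by rewrite IH -addn1 modnDml addn1 addnS.
Qed.

Lemma iter_ordS_neq m k (i : 'I_m) : 0 < k < m -> iter k (@ordS m) i != i.
Proof.
move=> km; apply/eqP => /(congr1 val); rewrite val_iter_ordS.
have li := ltn_ord i.
have [lt|ge] := ltnP (i + k) m; first by rewrite modn_small //=; lia.
by rewrite -(subnK ge) modnDr modn_small /=; lia.
Qed.

Lemma odd_ordS m (i : 'I_m.*2) : odd (ordS i) = ~~ odd i.
Proof.
rewrite /=; have [e|ne] := eqVneq i.+1 m.*2; first by rewrite e modnn; lia.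
by rewrite modn_small //; have := ltn_ord i; lia.
Qed.

Lemma odd_ord_pred m (i : 'I_m.*2) : odd (ord_pred i) = ~~ odd i.
Proof. by rewrite -{2}(ord_predK i) odd_ordS negbK. Qed.

Section ChordalPosets.
Context (d : Order.disp_t) (Q : finPOrderType d).

Definition chordal_poset := forall (m : nat) (q : 'I_m.*2 -> Q),
  6 <= m.*2 -> poset_cycle q -> proper_cycle q -> has_chord q.

Lemma has_chordPn m (q : 'I_m.*2 -> Q) : has_chord q \/
  forall i j : 'I_m.*2, ~~ odd i -> odd j -> (q i <= q j)%O ->
    j = ord_pred i \/ j = ordS i.
Proof.
have [/existsP[i /existsP[j /and5P[]]]|/existsPn N] :=
  boolP [exists i : 'I_m.*2, exists j : 'I_m.*2, [&& ~~ odd i, odd j,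
      j != ord_pred i, j != ordS i & (q i <= q j)%O]].
  by left; exists i, j.
right=> i j ei oj le; have /existsPn/(_ j) := N i.
by rewrite ei oj le andbT /= negb_and !negbK => /orP[/eqP|/eqP]; [left|right].
Qed.

(** A chordless cycle is proper: an extra comparability or equality, composed with relations of the
    cycle at its ends, yields relations between a lower and an upper element, and these hold only
    between neighbours. *)
Lemma poset_cycle_chord m (q : 'I_m.*2 -> Q) :
  chordal_poset -> 6 <= m.*2 -> poset_cycle q -> has_chord q.
Proof.
move=> chQ m6 cq; have [//|N] := has_chordPn q; apply: chQ => //.
have leS (i : 'I_m.*2) : ~~ odd i -> (q i <= q (ordS i))%O.
  by move=> ei; have := cq i; rewrite (negPf ei).
have leP (i : 'I_m.*2) : ~~ odd i -> (q i <= q (ord_pred i))%O.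
  by move=> ei; have := cq (ord_pred i); rewrite odd_ord_pred ei ord_predK.
have gtS (i : 'I_m.*2) : odd i -> (q (ordS i) <= q i)%O by move=> oi; have := cq i; rewrite oi.
have gtP (i : 'I_m.*2) : odd i -> (q (ord_pred i) <= q i)%O.
  by move=> oi; have := leS (ord_pred i); rewrite odd_ord_pred oi ord_predK; apply.
have S2 (i : 'I_m.*2) : ordS (ordS i) = i -> False.
  by move/eqP; apply/negP; apply: (@iter_ordS_neq _ 2); lia.
have S4 (i : 'I_m.*2) : ordS (ordS (ordS (ordS i))) = i -> False.
  by move/eqP; apply/negP; apply: (@iter_ordS_neq _ 4); lia.
have SP (i j : 'I_m.*2) : i = ord_pred j -> j = ordS i.
  by move=> ->; rewrite ord_predK.
have PS (i j : 'I_m.*2) : ord_pred i = j -> i = ordS j.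
  by move=> <-; rewrite ord_predK.
(* Here [q i] lies below both neighbours of [j], so these are neighbours of [i]; for [i] distinct
   from [j] the cycle would close after four steps. *)
have Neven (i j : 'I_m.*2) : ~~ odd i -> ~~ odd j -> (q i <= q j)%O -> i = j.
  move=> ei ej le; have le1 := le_trans le (leS _ ej).
  have le2 := le_trans le (leP _ ej).
  have [||/SP e1|/ordS_inj->//] := N _ _ _ _ le1; rewrite ?odd_ordS ?ei ?ej //.
  have [||/ord_pred_inj->//|/PS e2] := N _ _ _ _ le2; rewrite ?odd_ord_pred ?ei ?ej //.
  by case: (S4 j); rewrite -e1 -e2.
have Nodd (i j : 'I_m.*2) : odd i -> odd j -> (q i <= q j)%O -> i = j.
  move=> oi oj le; have le1 := le_trans (gtS _ oi) le.
  have le2 := le_trans (gtP _ oi) le.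
  have [||->|e1] := N _ _ _ _ le1; rewrite ?odd_ordS ?oi ?oj ?ordSK //.
  have [||/SP/PS e2|->] := N _ _ _ _ le2; rewrite ?odd_ord_pred ?oi ?oj ?ord_predK //.
  by case: (S4 i); rewrite -e1 -e2.
(* If two adjacent elements are equal, their outer neighbours become comparable; these are three
   steps apart, hence not adjacent in length at least 6. *)
have Neq (i j : 'I_m.*2) : ~~ odd i -> odd j -> q i = q j -> False.
  move=> ei oj e; have le : (q i <= q j)%O by rewrite e.
  have [||/SP e0|e0] := N _ _ _ _ le; rewrite ?ei ?oj //.
    have le1 : (q (ord_pred j) <= q (ordS i))%O.
      by apply: le_trans (gtP _ oj) _; rewrite -e leS.
    have [||/SP/PS e1|] := N _ _ _ _ le1; rewrite ?odd_ordS ?odd_ord_pred ?ei ?oj //.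
      by case: (S4 i); rewrite -e1 -e0.
    by rewrite ord_predK => e1; case: (S2 j); rewrite -e0 e1.
  have le1 : (q (ordS j) <= q (ord_pred i))%O.
    by apply: le_trans (gtS _ oj) _; rewrite -e leP.
  have [|||] := N _ _ _ _ le1; rewrite ?odd_ordS ?odd_ord_pred ?ei ?oj //.
    by rewrite ordSK => /PS e1; case: (S2 i); rewrite -e0 -e1.
  by move/PS => e1; case: (S4 j); rewrite -e1 -e0.
have Npar (i j : 'I_m.*2) : odd i = odd j -> (q i <= q j)%O -> i = j.
  by case oi: (odd i) => e; [apply: Nodd | apply: Neven]; rewrite -?e ?oi.
split=> [i j e|i j e ne].
  case oi: (odd i); case oj: (odd j).
  - by apply: Npar; rewrite ?oi ?oj ?e.
  - by case: (@Neq j i); rewrite ?oi ?oj.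
  - by case: (@Neq i j); rewrite ?oi ?oj.
  - by apply: Npar; rewrite ?oi ?oj ?e.
apply/negP => /orP[le|le]; case/eqP: ne; first exact: Npar.
by symmetry; apply: Npar.
Qed.

(** Interleaving gives the cycle [L 0 <= U 0 >= L 1 <= U 1 ...] of length [o.*2]. The last clauses
    say that [s] is neither [k] nor [k.+1] modulo [o]. *)
Lemma zigzag_chord (o : nat) (L U : nat -> Q) : chordal_poset -> 2 < o ->
  (forall k, (L k <= U k)%O) -> (forall k, (L k.+1 <= U k)%O) -> L o = L 0 ->
  exists s k, [/\ s < o, k < o, (L s <= U k)%O, s != k &
                  (s != k.+1) && ~~ ((s == 0) && (k.+1 == o))].
Proof.
move=> chQ o3 leLU leLSU Lo.
pose q (i : 'I_o.*2) := if odd i then U i./2 else L i./2.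
have cq : poset_cycle q.
  move=> i; rewrite /q odd_ordS; case oi: (odd i) => /=.
    have [e|ne] := eqVneq i.+1 o.*2.
      rewrite e modnn (_ : L 0./2 = L (i./2).+1) //.
      by rewrite /= -Lo; congr L; lia.
    rewrite modn_small; last by have := ltn_ord i; lia.
    by have -> : i.+1./2 = (i./2).+1 by lia.
  rewrite modn_small; last by have := ltn_ord i; lia.
  by have -> : i.+1./2 = i./2 by lia.
have [|i [j [ei oj ne1 ne2 le]]] := poset_cycle_chord chQ _ cq; first by lia.
have li := ltn_ord i; have lj := ltn_ord j.
exists i./2, j./2; split; first by lia.
- by lia.
- by move: le; rewrite /q (negPf ei) oj.
- apply: contraNneq ne2 => e; apply/eqP/val_inj; rewrite /= modn_small; lia.
- apply/andP; split.
    apply: contraNneq ne1 => e; apply/eqP/val_inj => /=.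
    have -> : (i + o.*2).-1 = j + o.*2 by lia.
    by rewrite modnDr modn_small.
  apply: contraNN ne1 => /andP[/eqP e1 /eqP e2]; apply/eqP/val_inj => /=.
  by rewrite modn_small; lia.
Qed.

End ChordalPosets.

(** * Ideal spans and kernels of monomial maps *)

Section IdealSpan.
Local Open Scope ring_scope.
Context (K : fieldType) (n : nat).
Implicit Types (S : {mpoly K[n]} -> Prop) (f g : {mpoly K[n]}).

Lemma in_ideal_span0 S : in_ideal_span S 0.
Proof. by exists [::]; rewrite big_nil. Qed.

Lemma in_ideal_span_gen S g : S g -> in_ideal_span S g.
Proof.
move=> Sg; exists [:: (1, g)]; rewrite big_seq1 mul1r; split=> // c.
by rewrite inE => /eqP->.
Qed.

Lemma in_ideal_spanD S f g :
  in_ideal_span S f -> in_ideal_span S g -> in_ideal_span S (f + g).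
Proof.
move=> [s [sS ->]] [t [tS ->]]; exists (s ++ t); rewrite big_cat; split=> // c.
by rewrite mem_cat => /orP[/sS|/tS].
Qed.

Lemma in_ideal_spanM S f g : in_ideal_span S g -> in_ideal_span S (f * g).
Proof.
move=> [s [sS ->]]; exists [seq (f * c.1, c.2) | c <- s]; split.
  by move=> c' /mapP[c cs ->]; exact: sS cs.
by rewrite big_map mulr_sumr; apply: eq_bigr => c _; rewrite mulrA.
Qed.

Lemma in_ideal_span_sum S (I : eqType) (r : seq I) (F : I -> {mpoly K[n]}) :
  (forall i, i \in r -> in_ideal_span S (F i)) ->
  in_ideal_span S (\sum_(i <- r) F i).
Proof.
move=> SF; rewrite big_seq; apply: (big_ind (in_ideal_span S)) => //.
- exact: in_ideal_span0.
- exact: in_ideal_spanD.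
Qed.

Lemma in_ideal_span_sub S (J : {mpoly K[n]} -> Prop) :
  J 0 -> (forall f g, J f -> J g -> J (f + g)) -> (forall f g, J g -> J (f * g)) ->
  (forall g, S g -> J g) -> forall f, in_ideal_span S f -> J f.
Proof.
move=> J0 JD JM SJ f [s [sS ->]]; rewrite big_seq.
by apply: big_ind => // c /sS/SJ; apply: JM.
Qed.

End IdealSpan.

Section ToricKernel.
Local Open Scope ring_scope.
Context (K : fieldType) (n N : nat) (lq : n.-tuple {mpoly K[N]}).
Context (F : 'X_{1..n} -> 'X_{1..N}).
Hypothesis lqF : forall u, 'X_[u] \mPo lq = 'X_[F u].

(** Over each fiber of [F] the coefficients of [f] sum to zero, so subtracting from every monomial a
    fixed representative of its fiber does not change [f] and writes it as a combination of
    binomials. *)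
Lemma toric_kernel (S : {mpoly K[n]} -> Prop) (f : {mpoly K[n]}) :
  (forall u v, F u = F v -> in_ideal_span S ('X_[u] - 'X_[v])) ->
  f \mPo lq = 0 -> in_ideal_span S f.
Proof.
move=> SF f0.
have fib w : \sum_(u <- msupp f) f@_u * (F u == w)%:R = 0.
  have := congr1 (mcoeff w) f0; rewrite comp_mpolyEX mcoeff0 => e.
  by rewrite -[RHS]e raddf_sum; apply: eq_bigr => u _; rewrite /= lqF mcoeffZ mcoeffX.
have sum0 (h : 'X_{1..N} -> {mpoly K[n]}) :
    \sum_(u <- msupp f) f@_u *: h (F u) = 0.
  pose W := undup [seq F u | u <- msupp f].
  transitivity (\sum_(u <- msupp f) \sum_(w <- W) (f@_u * (F u == w)%:R) *: h w).
    apply: eq_big_seq => u uf; rewrite (bigD1_seq (F u)) ?undup_uniq //=; last first.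
      by rewrite mem_undup map_f.
    rewrite eqxx mulr1 big1 ?addr0 // => w /negPf.
    by rewrite eq_sym => ->; rewrite mulr0 scale0r.
  by rewrite exchange_big big1 // => w _; rewrite -scaler_suml fib scale0r.
(* A representative taken in the support of [f]; the default is reached only for a [w] with no
   preimage there. *)
pose rho w := head 0%MM [seq u <- msupp f | F u == w].
have rhoF u : u \in msupp f -> F (rho (F u)) = F u.
  move=> uf; have : u \in [seq v <- msupp f | F v == F u].
    by rewrite mem_filter eqxx.
  rewrite /rho; case E: [seq v <- _ | _] => [//|v r] _ /=.
  have : v \in [seq v <- msupp f | F v == F u] by rewrite E mem_head.
  by rewrite mem_filter => /andP[/eqP].
have -> : f = \sum_(u <- msupp f) (f@_u)%:MP * ('X_[u] - 'X_[rho (F u)]).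
  under eq_bigr do rewrite mul_mpolyC scalerBr.
  by rewrite big_split /= -mpolyE sumrN (sum0 (fun w => 'X_[rho w])) subr0.
apply: in_ideal_span_sum => u uf; apply/in_ideal_spanM/SF.
by rewrite rhoF.
Qed.

End ToricKernel.

(** * Monomials as sequences of isotone maps, and their images *)

Lemma mnm_seq (I : finType) (u : 'X_{1..#|I|}) : exists s : seq I,
  size s = mdeg u /\ u = (\sum_(i <- s) U_(enum_rank i))%MM.
Proof.
have [d] := ubnP (mdeg u); elim: d u => // d IH u lt_d.
have [/eqP|[i ui]] : mdeg u = 0 \/ exists i, 0 < u i.
  have [/existsP[i ui]|/existsPn u0] := boolP [exists i, 0 < u i].
    by right; exists i.
  by left; rewrite mdegE big1 // => i _; apply/eqP; rewrite -leqn0 leqNgt.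
  by rewrite mdeg_eq0 => /eqP->; exists [::]; rewrite mdeg0 big_nil.
have /submK uE : (U_(i) <= u)%MM.
  by apply/mnm_lepP => j; rewrite mnm1E; case: eqP => // <-.
have [|s [ss su]] := IH (u - U_(i))%MM.
  by move: lt_d; rewrite -{1}uE mdegD mdeg1 addn1 ltnS.
exists (enum_val i :: s); rewrite /= big_cons enum_valK -su addmC; split=> //.
by rewrite ss -[in RHS]uE mdegD mdeg1 addn1.
Qed.

Lemma mpolyX_sum (R : nzRingType) n (I : Type) (r : seq I) (F : I -> 'X_{1..n}) :
  ('X_[R, \sum_(i <- r) F i] = \prod_(i <- r) 'X_[R, F i])%R.
Proof. exact: (big_morph _ (@mpolyXD n R) (@mpolyX0 n R)). Qed.

Section IsotonianMap.
Local Open Scope ring_scope.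
Context (K : fieldType) (dP dQ : Order.disp_t).
Context (P : finPOrderType dP) (Q : finPOrderType dQ).

Local Notation Hom := (isoHom P Q).
Implicit Types (phi psi : Hom) (s t : seq Hom).

Definition fiber_mnm phi : 'X_{1..#|{: P * Q}|} :=
  (\sum_(p : P) U_(enum_rank (p, val phi p)))%MM.

Lemma isoMonomialE phi : isoMonomial K phi = 'X_[fiber_mnm phi].
Proof. by rewrite mpolyX_sum. Qed.

Lemma isoMapX (u : 'X_{1..#|Hom|}) :
  'X_[u] \mPo [tuple isoMonomial K (enum_val i) | i < #|Hom|] =
  'X_[\sum_i fiber_mnm (enum_val i) *+ u i]%MM.
Proof.
rewrite comp_mpolyX mpolyX_sum; apply: eq_bigr => i _.
by rewrite tnth_mktuple isoMonomialE mpolyXn.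
Qed.

Lemma isoMap_prod s : isoMap (\prod_(phi <- s) 'X_(enum_rank phi)) =
  'X_[\sum_(phi <- s) fiber_mnm phi] :> {mpoly K[_]}.
Proof.
rewrite /isoMap; elim: s => [|phi s IH].
  by rewrite !big_nil mpolyX0 comp_mpoly1.
rewrite !big_cons mpolyXD rmorphM /= IH comp_mpolyXU.
by rewrite -tnth_nth tnth_mktuple enum_rankK isoMonomialE.
Qed.

Lemma fiber_mnm_sumE s p q : (\sum_(phi <- s) fiber_mnm phi)%MM (enum_rank (p, q)) =
  count_mem q [seq val phi p | phi <- s].
Proof.
rewrite mnm_sumE -sum1_count big_map [RHS]big_mkcond /=; apply: eq_bigr => phi _.
rewrite mnm_sumE (bigD1 p) //= mnm1E (inj_eq enum_rank_inj) xpair_eqE eqxx /=.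
rewrite big1 ?addn0; first by case: eqP.
move=> p' /negPf ne; rewrite mnm1E (inj_eq enum_rank_inj) xpair_eqE ne //.
Qed.

Lemma fiber_mnm_sumP s t : reflect
  (forall p, perm_eq [seq val phi p | phi <- s] [seq val phi p | phi <- t])
  ((\sum_(phi <- s) fiber_mnm phi)%MM == (\sum_(phi <- t) fiber_mnm phi)%MM).
Proof.
apply: (iffP eqP) => [/mnmP e p|e].
  by apply/allP => q _ /=; rewrite -!fiber_mnm_sumE e.
apply/mnmP => i; rewrite -(enum_valK i); case: (enum_val i) => p q.
by rewrite !fiber_mnm_sumE; exact: (seq.permP (e p)).
Qed.

(** Both images are monomials, so their difference vanishes only if the exponents agree; the
    exponent at [(p, q)] counts the maps with value [q] at [p]. *)
Lemma isoIdeal_binomial s t :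
  isoIdeal (\prod_(phi <- s) 'X_(enum_rank phi) -
            \prod_(phi <- t) 'X_(enum_rank phi) : {mpoly K[_]}) <->
  (forall p, perm_eq [seq val phi p | phi <- s] [seq val phi p | phi <- t]).
Proof.
rewrite /isoIdeal /isoMap comp_mpolyB -!/(isoMap _) !isoMap_prod.
split=> [/eqP|/fiber_mnm_sumP/eqP->]; last exact: subrr.
rewrite subr_eq0 => /eqP/(congr1 (mcoeff (\sum_(phi <- t) fiber_mnm phi)%MM)).
rewrite !mcoeffX eqxx => e; apply/fiber_mnm_sumP; move: e.
by case: eqP => // _ /esym/eqP; rewrite oner_eq0.
Qed.

End IsotonianMap.

(** * The order or its dual, to treat rooted and co-rooted components at once *)

Definition dle (d : Order.disp_t) (T : porderType d) (b : bool) (x y : T) :=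
  if b then (x <= y)%O else (y <= x)%O.

Section DirectedOrder.
Context (d : Order.disp_t) (T : porderType d) (b : bool).
Implicit Types x y z : T.

Lemma dle_refl x : dle b x x. Proof. by rewrite /dle lexx if_same. Qed.

Lemma dle_trans y x z : dle b x y -> dle b y z -> dle b x z.
Proof. by rewrite /dle; case: b => h1 h2; [apply: le_trans h2 | apply: le_trans h1]. Qed.

Lemma dle_anti x y : dle b x y -> dle b y x -> x = y.
Proof. by rewrite /dle; case: b => h1 h2; apply/le_anti/andP. Qed.

Lemma comparable_dle x y : (x >=< y)%O -> dle b x y \/ dle b y x.
Proof. by rewrite /dle; case: b => /orP[]; auto. Qed.

End DirectedOrder.

(** Along a cycle of [nu] the values of [f] and of [g] after [s] form a zigzag in [Q]. The values of
    [f] are its lower elements if [b] holds and its upper ones otherwise. *)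
Lemma chordal_rel_dle (d : Order.disp_t) (Q : finPOrderType d) (b : bool) (n : nat)
  (f g : 'I_n -> Q) : chordal_poset Q -> chordal_rel (fun i j => dle b (f i) (g j)).
Proof.
move=> chQ s nu x Vs Vnu; set o := fingraph.order nu x => o_gt2.
have it_o k : iter (k + o) nu x = iter k nu x.
  by rewrite iterD iter_order //; apply: perm_inj.
have V1 k : dle b (f (iter k nu x)) (g (s (iter k.+1 nu x))).
  by have := Vnu (iter k nu x); rewrite permM.
have V0 k : dle b (f (iter k nu x)) (g (s (iter k nu x))) by apply: Vs.
pose fk k := f (iter k nu x); pose gk k := g (s (iter k nu x)).
case: b V0 V1 {Vs Vnu} => V0 V1.
  (* The shift by one is needed because the common upper bound of [fk k] and [fk k.+1] is
     [gk k.+1]. *)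
  have [|||i [k [io ko le ne1 /andP[ne2 ne3]]]] :=
    @zigzag_chord _ _ o fk (fun k => gk k.+1) chQ o_gt2.
  - exact: V1.
  - by move=> k; apply: V0.
  - by rewrite /fk -[o]add0n it_o.
  (* The exponent is [k.+1 - i] modulo [o], so [o] is added when the chord wraps around. *)
  exists i; have [ik|ki] := ltnP i k.
    exists (k.+1 - i); split; last by rewrite subnK ?le //; lia.
    move: ne3; case: eqP => //=; lia.
  exists (k.+1 + o - i); split; last by rewrite subnK ?it_o ?le //; lia.
  by lia.
have [|||i [k [io ko le ne1 /andP[ne2 ne3]]]] := @zigzag_chord _ _ o gk fk chQ o_gt2.
- exact: V0.
- exact: V1.
- by rewrite /gk -[o]add0n it_o.
exists k; have [ik|ki] := ltnP i k.
  exists (i + o - k); split; last by rewrite subnK ?it_o ?le //; lia.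
  move: ne3; case: (eqVneq i 0) => //=; lia.
exists (i - k); split; last by rewrite subnK ?le //; lia.
by lia.
Qed.

(** * Forest structure of [P] *)

Section ForestSign.
Context (d : Order.disp_t) (P : finPOrderType d).

(** The sign directs each component away from its root: for [true] the elements below any given one
    form a chain, for [false] those above it. *)
Definition forest_sign (s : P -> bool) :=
  (forall x y, (x <= y)%O -> s x = s y) /\
  (forall x y z, dle (s z) x z -> dle (s z) y z -> (x >=< y)%O).

Lemma antichain_forest_sign : is_antichain P -> forest_sign (fun _ => true).
Proof.
move=> aP; have le_eq (x y : P) : (x <= y)%O -> x = y.
  by move=> le; case: (eqVneq x y) => // /aP; rewrite (le_comparable le).
by split=> // x y z /le_eq-> /le_eq->; apply: comparablexx.
Qed.

Lemma le_connect_hasse (x y : P) : (x <= y)%O -> connect (@hasse _ P) x y.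
Proof.
have [n] := ubnP #|[set z | (x < z < y)%O]|; elim: n x y => // n IH x y lt_n le_xy.
have [->|ne] := eqVneq x y; first exact: connect0.
have lt_xy : (x < y)%O by rewrite lt_neqAle ne.
have [cov|] := boolP (covered_by x y); first by apply: connect1; rewrite /hasse cov.
rewrite /covered_by lt_xy /= => /forallPn[z]; rewrite negbK => /andP[xz zy].
apply: (@connect_trans _ _ z); apply: IH; rewrite ?ltW //;
  apply: leq_trans (lt_n : (_ <= n)%N); apply: proper_card; apply/properP; split.
- by apply/subsetP => t; rewrite !inE => /andP[-> /lt_trans->].
- by exists z; rewrite !inE ?xz ?zy // ltxx andbF.
- by apply/subsetP => t; rewrite !inE => /andP[/(lt_trans xz)-> ->].
- by exists z; rewrite !inE ?xz ?zy // ltxx.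
Qed.

(** The sign of [x] is the truth value of the chain condition of [rooted] on the component of [x];
    where it fails, the component is co-rooted and the dual condition holds. *)
Lemma rooted_forest_sign :
  (forall C : {set P}, C \in components P -> rooted C \/ co_rooted C) ->
  exists s, forest_sign s.
Proof.
move=> rootP; pose C x : {set P} := [set y | connect (@hasse _ P) x y].
pose s x := [forall p in C x, forall y in C x, forall z in C x,
  (y <= p)%O ==> (z <= p)%O ==> (y >=< z)%O].
have hsym : connect_sym (@hasse _ P).
  by apply: sym_connect_sym => x y; rewrite /hasse orbC.
have Ceq x y : (x <= y)%O -> C x = C y.
  move/le_connect_hasse => xy; apply/setP => z; rewrite !inE.
  exact: same_connect.
exists s; split=> [x y /Ceq e|x y z]; first by rewrite /s e.
have inC (u : P) : dle (s z) u z -> u \in C z.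
  rewrite inE /dle; case: (s z) => /le_connect_hasse //.
  by rewrite hsym.
move=> xz yz; have xC := inC _ xz; have yC := inC _ yz; move: xz yz.
have zz : z \in C z by rewrite inE.
rewrite /dle; case: ifP => [/forall_inP/(_ _ zz)/forall_inP sz xz yz|sz].
  by have /forall_inP/(_ _ yC) := sz _ xC; rewrite xz yz.
have [[_ rC]|[_ rC]] := rootP (C z) (imset_f _ isT); last first.
  move=> zx zy; have := rC z zz x y xC yC zx zy.
  by rewrite /Order.comparable orbC.
case/negP: sz; apply/forall_inP => p pC; apply/forall_inP => u uC.
by apply/forall_inP => v vC; apply/implyP => up; apply/implyP => vp;
  apply: rC uC vC up vp.
Qed.

Section Rank.
Variables (s : P -> bool) (s_forest : forest_sign s).

Lemma dle_sign b x y : dle b x y -> s x = s y.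
Proof. by rewrite /dle; case: b => /s_forest.1. Qed.

Definition forest_rank (c : P) := #|[set x | dle (s c) x c]|.

Lemma forest_rank_lt x c : x != c -> dle (s c) x c -> forest_rank x < forest_rank c.
Proof.
move=> ne le; apply: proper_card; apply/properP; rewrite (dle_sign le); split.
  by apply/subsetP => y; rewrite !inE => /dle_trans; apply.
exists c; rewrite !inE ?dle_refl //; apply: contra_neqN ne => le'.
exact: dle_anti le le'.
Qed.

Definition forest_parent (c p : P) := [/\ p != c, dle (s c) p c &
  forall x, x != c -> dle (s c) x c -> dle (s c) x p].

(** The elements strictly before [c] in the direction [s c] form a chain; when there are any, the
    one of maximal rank is the parent. *)
Lemma forest_parentP c :
  (forall x, dle (s c) x c -> x = c) \/ exists p, forest_parent c p.
Proof.
have [/existsP[x0 x0P]|/existsPn N] := boolP [exists x, (x != c) && dle (s c) x c].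
  pose below := [pred x | (x != c) && dle (s c) x c].
  right; case: (@arg_maxnP _ x0 below forest_rank x0P) => p /andP[pc lepc] pmax.
  exists p; split=> // x xc lexc.
  have [//|lepx] := comparable_dle (s c) (s_forest.2 _ _ _ lexc lepc).
  have [<-|px] := eqVneq p x; first exact: dle_refl.
  rewrite -(dle_sign lexc) in lepx.
  have := pmax x; rewrite /= xc lexc => /(_ isT).
  by rewrite leqNgt (forest_rank_lt px lepx).
by left=> x lexc; apply/eqP; have := N x; rewrite lexc andbT negbK.
Qed.

End Rank.
End ForestSign.

(** * Replacing a map on a subtree *)

Section Glue.
Context (dP dQ : Order.disp_t) (P : finPOrderType dP) (Q : finPOrderType dQ).
Variables (s : P -> bool) (s_forest : forest_sign s).
Local Notation Hom := (isoHom P Q).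
Implicit Types (phi psi : Hom) (c p : P).

Lemma isotone_dle (f : {ffun P -> Q}) b x y :
  isotone f -> dle b x y -> dle b (f x) (f y).
Proof.
move=> /forallP iso; have {}iso u v : (u <= v)%O -> (f u <= f v)%O.
  by have /forallP/(_ v)/implyP := iso u.
by rewrite /dle; case: b => /iso.
Qed.

Lemma isoHom_dle phi b x y : dle b x y -> dle b (val phi x) (val phi y).
Proof. exact: isotone_dle (valP phi). Qed.

Definition glue c phi psi : {ffun P -> Q} :=
  [ffun z => if dle (s c) c z then val psi z else val phi z].

(** Only comparable pairs [u], [v] with [v] inside the subtree of [c] and [u] outside matter. The
    chain condition puts [u] before [c], and the values compare through [phi p] and [psi c]. *)
Lemma isotone_glue c phi psi :
  (forall x, x != c -> dle (s c) x c ->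
     exists2 p, dle (s c) x p & dle (s c) (val phi p) (val psi c)) ->
  isotone (glue c phi psi).
Proof.
move=> hp; have mix u v : dle (s c) c v -> ~~ dle (s c) c u -> (u >=< v)%O ->
    dle (s c) u v /\ dle (s c) (val phi u) (val psi v).
  move=> cv cu /(comparable_dle (s c))[uv|vu]; last first.
    by rewrite (dle_trans cv vu) in cu.
  split=> //; have sc := dle_sign s_forest cv; rewrite sc in cv uv.
  have /(comparable_dle (s c))[cu'|uc] := s_forest.2 _ _ _ cv uv.
    by rewrite cu' in cu.
  have uc' : u != c by apply: contraNneq cu => ->; apply: dle_refl.
  have [p up pc] := hp _ uc' uc; apply: dle_trans (isoHom_dle phi up) _.
  by apply: dle_trans pc (isoHom_dle psi _); rewrite sc.
apply/forallP => x; apply/forallP => y; apply/implyP => xy; rewrite !ffunE.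
case: ifPn => cx; case: ifPn => cy.
- exact: (@isoHom_dle psi true).
- have [] := mix y x cx cy; first by rewrite comparable_sym le_comparable.
  rewrite /dle; case: (s c) cx cy => cx cy yx //.
  by case/negP: cy; rewrite /dle (le_anti (introT andP (conj xy yx))) in cx *.
- have [] := mix x y cy cx; first by rewrite le_comparable.
  rewrite /dle; case: (s c) cx cy => cx cy yx //.
  by case/negP: cx; rewrite /dle (le_anti (introT andP (conj xy yx))) in cy *.
- exact: (@isoHom_dle phi true).
Qed.

Lemma glue_root c phi psi : (forall x, dle (s c) x c -> x = c) ->
  isotone (glue c phi psi).
Proof. by move=> root; apply: isotone_glue => x /eqP xc /root. Qed.

(** This reduces the admissible exchanges at [c] to edges of a comparability graph on values at [p]
    and at [c]. *)
Lemma glue_parent c p phi psi : forest_parent s c p ->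
  isotone (glue c phi psi) = dle (s c) (val phi p) (val psi c).
Proof.
case=> pc lepc pmax; apply/idP/idP => [iso|le].
  have := isotone_dle iso lepc; rewrite !ffunE dle_refl.
  by case: ifP => // cp; rewrite (dle_anti lepc cp) eqxx in pc.
by apply: isotone_glue => x xc lexc; exists p => //; apply: pmax.
Qed.

(** At a root every glued map is isotone, so any chord will do. Otherwise [c] has a parent, which
    rules out an antichain and leaves the chordality of [Q]. *)
Lemma chordal_glue n c (G : 'I_n -> Hom) : chordal_poset Q \/ is_antichain P ->
  chordal_rel (fun i j => isotone (glue c (G i) (G j))).
Proof.
move=> chQ; have [root|[p pP]] := forest_parentP s_forest c.
  by move=> ? ? ? _ _ o2; exists 0, 2; split=> //; apply: glue_root.
have {}chQ : chordal_poset Q.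
  case: chQ => // aP; case: pP => /aP N + _.
  by move/negP: N; rewrite /dle /Order.comparable; case: (s c) => N le;
    case: N; rewrite le ?orbT.
move=> sg nu x; rewrite /matching => Vs Vnu o2.
have [|||r [t [to Vt]]] := @chordal_rel_dle _ _ (s c) n
   (fun i => val (G i) p) (fun j => val (G j) c) chQ sg nu x.
- by move=> i; rewrite -(glue_parent _ _ pP).
- by move=> i; rewrite -(glue_parent _ _ pP).
- by [].
by exists r, t; split=> //; rewrite (glue_parent _ _ pP).
Qed.

End Glue.

(** * Quadratic relations as exchanges between two maps *)

Section QuadraticMoves.
Local Open Scope ring_scope.
Context (K : fieldType) (dP dQ : Order.disp_t).
Context (P : finPOrderType dP) (Q : finPOrderType dQ).
Local Notation Hom := (isoHom P Q).
Local Notation T := {mpoly K[#|Hom|]}.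
Implicit Types (phi psi : Hom).

Lemma isoIdeal_span (S : T -> Prop) :
  (forall g, S g -> isoIdeal g) -> forall f, in_ideal_span S f -> isoIdeal f.
Proof.
move=> SJ; apply: in_ideal_span_sub => //; rewrite /isoIdeal /isoMap.
- exact: comp_mpoly0.
- by move=> f g f0 g0; rewrite comp_mpolyD f0 g0 addr0.
- by move=> f g g0; rewrite rmorphM /= g0 mulr0.
Qed.

Definition quadratic_relation (g : T) :=
  quadratic_squarefree_binomial g /\ isoIdeal g.

Definition swap_equiv phi psi phi' psi' := forall p,
  perm_eq [:: val phi p; val psi p] [:: val phi' p; val psi' p].

Lemma swap_equiv_diag phi phi' psi' : swap_equiv phi phi phi' psi' ->
  phi' = phi /\ psi' = phi.
Proof.
move=> eq2; suff e p : val phi' p = val phi p /\ val psi' p = val phi p.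
  by split; apply/val_inj/ffunP => p; case: (e p).
have /perm_mem e := eq2 p.
have {e} h q : q \in [:: val phi' p; val psi' p] -> q = val phi p.
  by rewrite -e !inE orbb => /eqP.
by split; apply: h; rewrite !inE eqxx ?orbT.
Qed.

Lemma isoIdeal_swap phi psi phi' psi' : swap_equiv phi psi phi' psi' ->
  isoIdeal ('X_(enum_rank phi) * 'X_(enum_rank psi) -
            'X_(enum_rank phi') * 'X_(enum_rank psi') : T).
Proof.
move=> eq2; have [_] := isoIdeal_binomial K [:: phi; psi] [:: phi'; psi'].
by rewrite !big_cons !big_nil !mulr1; apply.
Qed.

(* If [phi = psi], the relation is zero: this is why quadratic generators can be
   taken squarefree. *)
Lemma span_swap phi psi phi' psi' : swap_equiv phi psi phi' psi' ->
  in_ideal_span quadratic_relation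
    ('X_(enum_rank phi) * 'X_(enum_rank psi) -
     'X_(enum_rank phi') * 'X_(enum_rank psi')).
Proof.
move=> eq2; have [e|ne] := eqVneq phi psi.
  move: eq2; rewrite -e => /swap_equiv_diag[-> ->]; rewrite subrr.
  exact: in_ideal_span0.
have ne' : phi' != psi'.
  apply: contraNneq ne => e; have eq2' : swap_equiv phi' phi' phi psi.
    by move=> p; rewrite perm_sym {2}e.
  by have [-> ->] := swap_equiv_diag eq2'.
apply: in_ideal_span_gen; split; last exact: isoIdeal_swap.
have sf (a b : Hom) : a != b ->
    squarefree_mnm (U_(enum_rank a) + U_(enum_rank b))%MM.
  rewrite -(inj_eq enum_rank_inj) => /negPf ab i; rewrite mnmDE !mnm1E.
  by have [<-|_] := eqVneq (enum_rank a) i; rewrite ?leq_b1 // eq_sym ab.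
rewrite -!mpolyXD; split.
  by do 2!eexists; split; [apply: sf ne | apply: sf ne' | ].
by apply: rpredB; rewrite dhomogX /= mdegD !mdeg1.
Qed.

(** Distinct monomials cannot cancel, so homogeneity makes each of them a product of two variables;
    equal monomials give the zero case. *)
Lemma quadratic_binomialP (g : T) : quadratic_binomial g -> isoIdeal g ->
  g = 0 \/ exists phi psi phi' psi', swap_equiv phi psi phi' psi' /\
    g = 'X_(enum_rank phi) * 'X_(enum_rank psi) -
        'X_(enum_rank phi') * 'X_(enum_rank psi').
Proof.
move=> [[u [v ->]] homg]; have [->|ne] := eqVneq u v; first by rewrite subrr; left.
have hom w : ('X_[u] - 'X_[v] : T)@_w != 0 -> mdeg w = 2%N.
  by rewrite -mcoeff_msupp => /(dhomogP _ _ _ homg).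
have du : mdeg u = 2%N.
  by apply: hom; rewrite mcoeffB !mcoeffX eqxx [v == u]eq_sym (negPf ne) subr0 oner_eq0.
have dv : mdeg v = 2%N.
  by apply: hom; rewrite mcoeffB !mcoeffX eqxx (negPf ne) sub0r oppr_eq0 oner_eq0.
have [[|a [|b [|? ?]]] []] := mnm_seq u; rewrite ?du // => _ ->.
have [[|a' [|b' [|? ?]]] []] := mnm_seq v; rewrite ?dv // => _ ->.
rewrite !mpolyX_sum => /isoIdeal_binomial eq2; right; exists a, b, a', b'.
by rewrite !big_cons !big_nil !mulr1.
Qed.

Definition tuple_monomial n (G : 'I_n -> Hom) : T :=
  \prod_(k < n) 'X_(enum_rank (G k)).

Lemma tuple_monomial_tnth n (t : n.-tuple Hom) :
  tuple_monomial (tnth t) = \prod_(phi <- t) 'X_(enum_rank phi).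
Proof. by rewrite big_tuple. Qed.

Definition move_equiv n (G H : 'I_n -> Hom) :=
  in_ideal_span quadratic_relation (tuple_monomial G - tuple_monomial H).

Lemma move_equiv_eq n (G H : 'I_n -> Hom) : G =1 H -> move_equiv G H.
Proof.
move=> e; rewrite /move_equiv /tuple_monomial (eq_bigr (fun k => 'X_(enum_rank (H k)))).
  by rewrite subrr; apply: in_ideal_span0.
by move=> k _; rewrite e.
Qed.

Lemma move_equiv_trans n (G H L : 'I_n -> Hom) :
  move_equiv G H -> move_equiv H L -> move_equiv G L.
Proof.
move=> GH HL; rewrite /move_equiv -(subrKA (tuple_monomial H)).
exact: in_ideal_spanD.
Qed.

Lemma move_equiv_swap n (G H : 'I_n -> Hom) i j : i != j ->
  (forall k, k != i -> k != j -> G k = H k) ->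
  swap_equiv (G i) (G j) (H i) (H j) -> move_equiv G H.
Proof.
move=> ij GH eq2; rewrite /move_equiv /tuple_monomial.
have split_ij (L : 'I_n -> Hom) : \prod_(k < n) 'X_(enum_rank (L k)) =
    (\prod_(k < n | (k != i) && (k != j)) 'X_(enum_rank (L k))) *
    ('X_(enum_rank (L i)) * 'X_(enum_rank (L j))) :> T.
  by rewrite (bigD1 i) //= (bigD1 j) 1?eq_sym //= mulrA mulrC.
rewrite !split_ij (eq_bigr (fun k => 'X_(enum_rank (H k)))); last first.
  by move=> k /andP[ki kj]; rewrite GH.
by rewrite -mulrBr; apply/in_ideal_spanM/span_swap.
Qed.

End QuadraticMoves.

(** * Connecting the fibers and generating the ideal *)

Section FiberConnected.
Local Open Scope ring_scope.
Context (K : fieldType) (dP dQ : Order.disp_t).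
Context (P : finPOrderType dP) (Q : finPOrderType dQ).
Local Notation Hom := (isoHom P Q).
Variables (s : P -> bool) (s_forest : forest_sign s).
Hypothesis chQ : chordal_poset Q \/ is_antichain P.

Definition glue_tuple n c (G : 'I_n -> Hom) (sg : 'S_n) (k : 'I_n) : Hom :=
  insubd (G k) (glue s c (G k) (G (sg k))).

(** The identity matching returns [G] itself, and matchings differing by a transposition give tuples
    differing by one exchange on the subtree of [c]; [matchings_connected] does the rest. *)
Lemma glue_move_equiv n c (G : 'I_n -> Hom) (sg : 'S_n) :
  matching (fun i j => isotone (glue s c (G i) (G j))) sg ->
  move_equiv K G (glue_tuple c G sg).
Proof.
set V := fun i j => _ => Vsg; have V1 : matching V 1%g.
  move=> i; rewrite perm1 /V.
  have -> : glue s c (G i) (G i) = val (G i) by apply/ffunP => z; rewrite ffunE if_same.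
  exact: valP.
have valG t k : matching V t -> val (glue_tuple c G t k) = glue s c (G k) (G (t k)).
  by move=> Vt; rewrite val_insubd; have := Vt k; rewrite /V => ->.
apply: (@move_equiv_trans _ _ _ _ _ _ _ (glue_tuple c G 1%g)).
  apply: move_equiv_eq => k; apply/val_inj; rewrite valG // perm1.
  by apply/ffunP => z; rewrite ffunE if_same.
apply: (matchings_connected (V := V)
  (E := fun t u => move_equiv K (glue_tuple c G t) (glue_tuple c G u))) => //.
- exact: chordal_glue.
- by move=> t; apply: move_equiv_eq.
- by move=> t u v; apply: move_equiv_trans.
move=> t i j Vt Vt'; have [->|ij] := eqVneq i j.
  by rewrite tperm1 mul1g; apply: move_equiv_eq.
apply: (@move_equiv_swap _ _ _ _ _ _ _ _ i j) => //.
  move=> k ki kj; apply/val_inj; rewrite !valG // permM tpermD // eq_sym //.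
move=> p; rewrite !valG // !permM tpermL tpermR !ffunE.
case: ifP => // _; by apply/permPl/(perm_catC [:: _] [:: _]).
Qed.

(* By induction on the set [A] of elements of [P] at which [G] and [H] already
   agree: at the next element, exchanging the values of two maps on its whole
   subtree affects neither [A] nor the fibers. *)
Lemma fiber_connected n (G H : 'I_n -> Hom) :
  (forall p, exists sg : 'S_n, forall k, val (H k) p = val (G (sg k)) p) ->
  move_equiv K G H.
Proof.
suff step (A : {set P}) :
    (forall x y, forest_rank s x < forest_rank s y -> y \in A -> x \in A)%N ->
    (forall p, exists sg : 'S_n, forall k, val (H k) p = val (G (sg k)) p) ->
    {in A, forall p k, val (G k) p = val (H k) p} -> move_equiv K G H.
  by move=> GH; apply: (step set0) => // [x y _|p]; rewrite inE.
have [d] := ubnP #|~: A|; elim: d A G => // d IH A G lt_d clA GH AH.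
case: (pickP [pred x | x \notin A]) => [c0 c0A|AT]; last first.
  apply: move_equiv_eq => k; apply/val_inj/ffunP => p; apply: AH.
  by have := AT p; rewrite /= => /negbFE.
have [c cA cmin] := @arg_minnP _ c0 [pred x | x \notin A] (forest_rank s) c0A.
have [sg Hc] := GH c.
have below x : x != c -> dle (s c) x c -> x \in A.
  move=> xc lexc; apply: contraT => /cmin.
  by rewrite leqNgt (forest_rank_lt s_forest xc lexc).
(* [G k] and [H k] agree at the parent of [c], and [G (sg k)] takes at [c] the value of [H k], so
   the required comparison is isotonicity of [H k]. *)
have Vsg : matching (fun i j => isotone (glue s c (G i) (G j))) sg.
  move=> k; have [root|[p pP]] := forest_parentP s_forest c.
    exact: glue_root.
  rewrite (glue_parent _ _ _ pP) // -Hc; case: pP => pc lepc _.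
  by rewrite (AH _ (below _ pc lepc)); apply: isoHom_dle.
have valG' k : val (glue_tuple c G sg k) = glue s c (G k) (G (sg k)).
  by rewrite val_insubd; have := Vsg k => ->.
apply: (move_equiv_trans (glue_move_equiv Vsg)); apply: (IH (c |: A)).
- apply: leq_trans (lt_d : (_ <= d)%N); apply: proper_card; apply/properP; split.
    by apply/subsetP => x; rewrite !inE negb_or => /andP[].
  by exists c; rewrite !inE ?eqxx.
- move=> x y lt_xy; rewrite !inE => /predU1P[yc|yA]; last first.
    by rewrite (clA _ _ lt_xy yA) orbT.
  rewrite -yc; apply/orP; right; apply: contraT => /cmin.
  by rewrite leqNgt -yc lt_xy.
(* On the subtree of [c] the maps were permuted by [sg], which has to be undone. *)
- move=> p; have [pi Hp] := GH p; have [cp|cp] := boolP (dle (s c) c p).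
    exists (pi * sg^-1)%g => k.
    by rewrite valG' ffunE cp permM permKV.
  by exists pi => k; rewrite valG' ffunE (negPf cp).
(* A point of [A] in the subtree of [c] would have larger rank than [c] and force [c] into [A]. *)
- move=> p /setU1P[->|pA] k; rewrite valG' ffunE.
    by rewrite dle_refl Hc.
  case: ifPn => [cp|_]; last exact: AH.
  have cp' : c != p by apply: contraNneq cA => ->.
  rewrite /= (clA c p) // in cA; apply: forest_rank_lt => //.
  by rewrite -(dle_sign s_forest cp).
Qed.

Lemma isoIdeal_generated : (0 < #|P|)%N ->
  generated_by (@quadratic_squarefree_binomial K _) (@isoIdeal K _ _ P Q).
Proof.
move=> /card_gt0P[p0 _]; exists (@quadratic_relation K _ _ P Q).
split=> [g []|f] //; split; last by apply: isoIdeal_span => g [].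
move=> Jf; apply: (toric_kernel (@isoMapX K _ _ P Q) _ Jf) => u v Fuv.
have [t [_ ut]] := mnm_seq u; have [t' [_ vt]] := mnm_seq v.
have : isoIdeal ('X_[u] - 'X_[v] : {mpoly K[#|Hom|]}).
  by rewrite /isoIdeal /isoMap comp_mpolyB !isoMapX Fuv subrr.
rewrite ut vt !mpolyX_sum => /isoIdeal_binomial tt'.
(* Nonemptiness of [P] enters here: comparing values at [p0] gives both monomials the same
   degree. *)
have /eqP sz : size t' = size t by have /perm_size := tt' p0; rewrite !size_map.
have := @fiber_connected _ (tnth (in_tuple t)) (tnth (Tuple sz)).
rewrite /move_equiv !tuple_monomial_tnth; apply=> p.
have := tt' p; rewrite perm_sym => tt'p.
have /tuple_permP[sg /val_inj e] :
    perm_eq (map_tuple (fun phi : Hom => val phi p) (Tuple sz))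
            (map_tuple (fun phi : Hom => val phi p) (in_tuple t)) by [].
exists sg => k; have := congr1 (fun r => tnth r k) e.
by rewrite tnth_mktuple !tnth_map.
Qed.

End FiberConnected.

Lemma perm_eq_pair (T : eqType) (a b c e : T) : perm_eq [:: a; b] [:: c; e] ->
  c = a /\ e = b \/ c = b /\ e = a.
Proof.
move=> pe; have := perm_mem pe c; rewrite !inE eqxx /= => /orP[]/eqP ca.
  move: pe; rewrite ca perm_cons => /perm_mem/(_ e).
  by rewrite !inE eqxx => /eqP; left.
move: pe; rewrite ca -[[:: a; b]]/([:: a] ++ [:: b]) perm_catC perm_cons => /perm_mem/(_ e).
by rewrite !inE eqxx => /eqP; right.
Qed.

(** * Necessity of the chord condition *)

Section LongCycle.
Local Open Scope ring_scope.
Context (K : fieldType) (dP dQ : Order.disp_t).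
Context (P : finPOrderType dP) (Q : finPOrderType dQ).
Local Notation Hom := (isoHom P Q).
Local Notation T := {mpoly K[#|Hom|]}.
Variables (x y : P) (lt_xy : (x < y)%O).

Lemma isotone_step (a b : Q) : (a <= b)%O ->
  isotone [ffun z : P => if (y <= z)%O then b else a].
Proof.
move=> ab; apply/forallP => u; apply/forallP => v; apply/implyP => uv; rewrite !ffunE.
case: ifP => [yu|_]; first by rewrite (le_trans yu uv).
by case: ifP.
Qed.

Definition const_hom (a : Q) : Hom := Sub _ (isotone_step (lexx a)).

(** An edge [a <= b] of the comparability graph is realized by a map with value [a] at [x] and [b]
    at [y]; the default serves only for [a], [b] not in this order. *)
Definition step_hom (a b : Q) : Hom :=
  insubd (const_hom a) [ffun z : P => if (y <= z)%O then b else a].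

Lemma step_homE a b z : (a <= b)%O ->
  val (step_hom a b) z = if (y <= z)%O then b else a.
Proof. by move=> ab; rewrite val_insubd isotone_step // ffunE. Qed.

Lemma step_hom_lo a b : (a <= b)%O -> val (step_hom a b) x = a.
Proof. by move=> ab; rewrite step_homE // lt_geF. Qed.

Lemma step_hom_hi a b : (a <= b)%O -> val (step_hom a b) y = b.
Proof. by move=> ab; rewrite step_homE // lexx. Qed.

(* For a proper cycle without chord, the two matchings of its lower with its
   upper elements are isolated: the evaluation [t_phi |-> 1] if
   [(phi x, phi y)] is an edge of the first matching, and [0] otherwise, kills all
   quadratic relations, but not the difference of the two matchings. *)
Lemma quadratic_chordal :
  generated_by (@quadratic_binomial K _) (@isoIdeal K _ _ P Q) -> chordal_poset Q.
Proof.
move=> [S [Sq SJ]] m q m6 cq [qI _]; have [//|N] := has_chordPn q.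
have S2 (i : 'I_m.*2) : ordS (ordS i) = i -> False.
  by move/eqP; apply/negP; apply: (@iter_ordS_neq _ 2); lia.
have S4 (i : 'I_m.*2) : ordS (ordS (ordS (ordS i))) = i -> False.
  by move/eqP; apply/negP; apply: (@iter_ordS_neq _ 4); lia.
have leS (i : 'I_m.*2) : ~~ odd i -> (q i <= q (ordS i))%O.
  by move=> ei; have := cq i; rewrite (negPf ei).
have leP (i : 'I_m.*2) : ~~ odd i -> (q i <= q (ord_pred i))%O.
  by move=> ei; have := cq (ord_pred i); rewrite odd_ord_pred ei ord_predK.
pose E := [seq i <- enum 'I_m.*2 | ~~ odd (nat_of_ord i)].
have inE' i : (i \in E) = ~~ odd i by rewrite mem_filter mem_enum andbT.
have uE : uniq E by rewrite filter_uniq ?enum_uniq.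
(* The two matchings pair each lower element, of even index, with the next and with the previous
   upper one. *)
pose phi i := step_hom (q i) (q (ordS i)).
pose psi i := step_hom (q i) (q (ord_pred i)).
have JF : isoIdeal (\prod_(f <- [seq phi i | i <- E]) 'X_(enum_rank f) -
                    \prod_(f <- [seq psi i | i <- E]) 'X_(enum_rank f) : T).
  apply/isoIdeal_binomial => p.
  have mapE (h : 'I_m.*2 -> Hom) (r : 'I_m.*2 -> 'I_m.*2) :
      (forall i : 'I_m.*2, ~~ odd i -> val (h i) p = q (r i)) ->
      [seq val f p | f : Hom <- map h E] =
       map q (map r E).
    by rewrite -!map_comp => hr; apply/eq_in_map => i; rewrite inE' => /hr.
  have [yp|/negPf yp] := boolP (y <= p)%O; last first.
    rewrite (mapE phi id) => [|i ei]; last by rewrite step_homE ?yp ?leS.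
    rewrite (mapE psi id) => [|i ei]; last by rewrite step_homE ?yp ?leP.
    exact: perm_refl.
  rewrite (mapE phi (@ordS _)) => [|i ei]; last by rewrite step_homE ?yp ?leS.
  rewrite (mapE psi (@ord_pred _)) => [|i ei]; last by rewrite step_homE ?yp ?leP.
  apply: perm_map; apply: uniq_perm; rewrite ?map_inj_uniq //;
    [exact: ordS_inj | exact: ord_pred_inj | move=> j].
  rewrite -{1}(ord_predK j) -{2}(ordSK j) !mem_map ?inE';
    [|exact: ord_pred_inj|exact: ordS_inj].
  by rewrite odd_ordS odd_ord_pred.
pose on (f : Hom) := [exists i : 'I_m.*2,
  [&& ~~ odd i, val f x == q i & val f y == q (ordS i)]].
have onP (f : Hom) : reflect (exists i : 'I_m.*2,
    [/\ ~~ odd i, val f x = q i & val f y = q (ordS i)]) (on f).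
  apply: (iffP existsP) => [[i /and3P[? /eqP ? /eqP ?]]|[i [? ? ?]]]; exists i => //.
  by apply/and3P; split=> //; apply/eqP.
have on_swap (f g f' g' : Hom) : swap_equiv f g f' g' -> on f && on g -> on f' && on g'.
  move=> eq2 /andP[/onP[i [ei fx fy]] /onP[j [ej gx gy]]].
  have iso (h : Hom) : (val h x <= val h y)%O.
    by apply: (@isoHom_dle _ _ _ _ h true); apply: ltW.
  (* An exchange that mixes two edges of the first matching would need a chord, unless the edges
     coincide. *)
  have mixed : (q i <= q (ordS j))%O -> (q j <= q (ordS i))%O -> i = j.
    move=> le1 le2.
    have [||e1|/ordS_inj->//] := N _ _ _ _ le1; rewrite ?odd_ordS ?ei ?ej //.
    have [||e2|/ordS_inj->//] := N _ _ _ _ le2; rewrite ?odd_ordS ?ei ?ej //.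
    by case: (S4 i); rewrite e2 ord_predK e1 ord_predK.
  have := perm_eq_pair (eq2 x); have := perm_eq_pair (eq2 y); rewrite fx fy gx gy.
  have := iso f'; have := iso g'.
  move=> leg lef [] [f'y g'y] [] [f'x g'x]; rewrite f'x f'y g'x g'y in leg lef.
  - by apply/andP; split; apply/onP; [exists i|exists j].
  - have ij := mixed leg lef; subst j.
    by apply/andP; split; apply/onP; exists i.
  - have ij := mixed lef leg; subst j.
    by apply/andP; split; apply/onP; exists i.
  - by apply/andP; split; apply/onP; [exists j|exists i].
pose w (k : 'I_#|Hom|) : K := (on (enum_val k))%:R.
have wX (f : Hom) : meval w 'X_(enum_rank f) = (on f)%:R.
  by rewrite mevalXU /w enum_rankK.
have w0 (f : T) : in_ideal_span S f -> meval w f = 0.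
  apply: (@in_ideal_span_sub _ _ _ (fun f => meval w f = 0)).
  - exact: meval0.
  - by move=> g h g0 h0; rewrite mevalD g0 h0 addr0.
  - by move=> g h h0; rewrite mevalM h0 mulr0.
  move=> g Sg; have Jg : isoIdeal g by apply/SJ/in_ideal_span_gen.
  have [->|[f1 [f2 [f1' [f2' [eq2 ->]]]]]] := quadratic_binomialP (Sq _ Sg) Jg.
    exact: meval0.
  rewrite mevalB !mevalM !wX -!natrM !mulnb.
  suff -> : on f1 && on f2 = on f1' && on f2' by rewrite subrr.
  apply/idP/idP; apply: on_swap => // p.
  by rewrite perm_sym.
have {JF} /SJ/w0 := JF; rewrite mevalB !rmorph_prod /= !big_map.
rewrite big_seq big1 => [|i]; last first.
  rewrite inE' wX => ei; suff -> : on (phi i) by [].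
  by apply/onP; exists i; rewrite /phi step_hom_lo ?step_hom_hi ?leS.
have lt0 : (0 < m.*2)%N by lia.
(* The first product evaluates to 1; one factor off the first matching makes the second vanish, and
   index 0 provides it because [q] is injective and its two neighbours are distinct. *)
rewrite (bigD1_seq (Ordinal lt0)) ?inE' //= wX.
suff -> : on (psi (Ordinal lt0)) = false.
  by rewrite mul0r subr0 => /eqP; rewrite oner_eq0.
apply/onP => -[i [ei]]; rewrite /psi step_hom_lo ?step_hom_hi ?leP //.
move=> /qI <- /qI e; apply: (S2 (Ordinal lt0)).
by rewrite -e ord_predK.
Qed.

End LongCycle.

Theorem theorem4p2 (K : fieldType) (dP dQ : Order.disp_t)
    (P : finPOrderType dP) (Q : finPOrderType dQ) (P_nonempty : (0 < #|P|)%N) :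
  (is_antichain P ->
     generated_by (@quadratic_squarefree_binomial K _) (@isoIdeal K _ _ P Q))
  /\
  (~ is_antichain P ->
   (forall C : {set P}, C \in components P -> rooted C \/ co_rooted C) ->
     (generated_by (@quadratic_binomial K _) (@isoIdeal K _ _ P Q) <->
      generated_by (@quadratic_squarefree_binomial K _) (@isoIdeal K _ _ P Q))
     /\
     (generated_by (@quadratic_squarefree_binomial K _) (@isoIdeal K _ _ P Q) <->
      (forall (m : nat) (q : 'I_m.*2 -> Q),
         (6 <= m.*2)%N -> poset_cycle q -> proper_cycle q -> has_chord q))).
Proof.
split=> [aP|naP rootP].
  by apply: isoIdeal_generated (antichain_forest_sign aP) _ P_nonempty; right.
have sq_q : generated_by (@quadratic_squarefree_binomial K _) (@isoIdeal K _ _ P Q) ->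
    generated_by (@quadratic_binomial K _) (@isoIdeal K _ _ P Q).
  move=> [S [Ssq SJ]]; exists S; split=> // g /Ssq[[u [v [_ _ ->]]] hom].
  by split=> //; exists u, v.
have [x [y lt_xy]] : exists x y : P, (x < y)%O.
  have [/existsP[x /existsP[y]]|/existsPn N] :=
      boolP [exists x : P, exists y : P, (x < y)%O].
    by exists x, y.
  case: naP => x y ne; apply/negP => /orP[le|le].
    by have /existsPn/(_ y) := N x; rewrite lt_neqAle ne le.
  by have /existsPn/(_ x) := N y; rewrite lt_neqAle eq_sym ne le.
have [s s_forest] := rooted_forest_sign rootP.
have ch_sq : chordal_poset Q ->
    generated_by (@quadratic_squarefree_binomial K _) (@isoIdeal K _ _ P Q).
  by move=> chQ; apply: isoIdeal_generated s_forest _ P_nonempty; left.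
have q_ch := @quadratic_chordal K _ _ P Q x y lt_xy.
by split; split; [move/q_ch/ch_sq | exact: sq_q | move/sq_q/q_ch | exact: ch_sq].
Qed.
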